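(* Let $G$ be a finite group, let $N$ be a normal abelian subgroup of $G$, and let $H$ and $H'$ be supersoluble subgroups of $G$, each of which is a complement of $N$ in $G$. Suppose that for each prime $p$ there exist a Sylow $p$-subgroup $P$ of $H$ and an element $g\in G$ such that $g^{-1}Pg\leq H'$. Then $H$ and $H'$ are conjugate in $G$.
   Context: A subgroup $H$ of a group $G$ is a complement of a normal subgroup $N$ of $G$ if $NH=G$ and $N\cap H=1$ (so that $G\cong N\rtimes H$). A group $X$ is supersoluble if it possesses a series $1=X_0\leq X_1\leq\dots\leq X_s=X$ with each $X_i$ normal in $X$ and each quotient $X_{i+1}/X_i$ cyclic for $0\leq i<s$. *)

(* Defs.v *)
From mathcomp Require Import all_boot all_fingroup all_solvable.

Set Implicit Arguments.
Unset Strict Implicit.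
Unset Printing Implicit Defensive.

Local Open Scope group_scope.

(* [F i.+1 / F i] only involves the part of [F i.+1] normalising [F i]; as
   [F i <| X] and [F i.+1 \subset X], this is all of [F i.+1]. *)
Definition supersoluble (gT : finGroupType) (X : {group gT}) : Prop :=
  exists (s : nat) (F : nat -> {group gT}),
    [/\ F 0 = 1%G,
        F s = X,
        forall i, i <= s -> F i <| X,
        forall i, i < s -> F i \subset F i.+1
      & forall i, i < s -> cyclic (F i.+1 / F i)].

(* Main.v *)
Require Import Defs.
From mathcomp Require Import all_boot all_fingroup all_solvable.
From mathcomp Require Import ssralg.

(** View [N] as a module for [H], acting by conjugation. Each [h] in [H] is
    congruent modulo [N] to exactly one element [f h] of [H'], and
    [c h = h^-1 * f h] is a 1-cocycle of [H] with values in [N]. An element [n]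
    of [N] conjugates a subgroup [P] of [H] into [H'] exactly when [c] agrees
    on [P] with the coboundary [x |-> [~ x, n]]; so the task is to show that [c]
    is a coboundary on [H], and the local hypothesis says that it is one on a
    Sylow [p]-subgroup for each [p] (an element of [G = H * N] conjugating [P]
    into [H'] splits into a factor in [H], which replaces [P] by another Sylow
    subgroup of [H], and a factor in [N]).

    If [c] is a coboundary on a subgroup [P] of [H], then summing over the
    cosets of [P] shows that [#|H : P|] times [c] is a coboundary on [H]
    ([cocycle_transfer]). The integers [k] such that [k] times [c] is a
    coboundary are the multiples of one positive [d], the order of the class of
    [c] in [H^1(H, N)]. By the above, [d] divides the index of a Sylow
    [p]-subgroup, for every prime [p], so no prime divides [d], and [c] is
    itself a coboundary ([cocycle_local_global]). *)

Set Implicit Arguments.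
Unset Strict Implicit.
Unset Printing Implicit Defensive.

Local Open Scope group_scope.

Import GRing.Theory FiniteModule.

Definition cocycle_on (gT : finGroupType) (A : {group gT}) (abA : abelian A)
    (H : {set gT}) (c : gT -> fmod_of abA) : Prop :=
  {in H &, forall x y, c (x * y) = (c x ^@ y + c y)%R}.

(** The sign makes [fmod n] bound the commutator map [x |-> [~ x, n]]. *)
Definition bounded_by (gT : finGroupType) (A : {group gT}) (abA : abelian A)
    (H : {set gT}) (c : gT -> fmod_of abA) (b : fmod_of abA) : bool :=
  [forall x in H, c x == b - b ^@ x]%R.

(** Subtracting the coboundary of [b] from [c] leaves a cocycle [e] which
    vanishes on [P], hence is constant on the cosets [P :* x]. The sum [s] of
    the values of [e] over these cosets satisfies
    [s ^@ h = s - e h *+ #|H : P|], as right translation by [h] permutes them. *)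
Lemma cocycle_transfer (gT : finGroupType) (A : {group gT}) (abA : abelian A)
    (H P : {group gT}) (c : gT -> fmod_of abA) (b : fmod_of abA) :
    H \subset 'N(A) -> P \subset H -> cocycle_on H c -> bounded_by P c b ->
  exists a, bounded_by H (fun x => c x *+ #|H : P|)%R a.
Proof.
move=> /subsetP nAH /subsetP sPH cM /forall_inP cP.
pose e x := (c x - (b - b ^@ x))%R.
have eM x y : x \in H -> y \in H -> e (x * y) = (e x ^@ y + e y)%R.
  move=> Hx Hy; rewrite /e cM // actrM ?nAH // !(actAr, actNr).
  by rewrite !opprB [RHS]addrACA; congr +%R; rewrite [RHS]addrA subrK.
have eP x : x \in P -> e x = 0%R by rewrite /e => /cP/eqP->; rewrite subrr.
have eMP x y : x \in P -> y \in H -> e (x * y) = e y.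
  by move=> Px Hy; rewrite eM ?(sPH x) // (eP x) // act0r add0r.
pose s := (\sum_(C in rcosets P H) e (repr C))%R.
have sJ x : x \in H -> s = (s ^@ x + e x *+ #|H : P|)%R.
  move=> Hx; rewrite {1}/s (reindex_acts _ (actsRs_rcosets P H) Hx) /=.
  rewrite /s (actr_sum x) -sumr_const -big_split /=.
  apply: eq_bigr => _ /rcosetsP[y Hy ->]; rewrite rcosetE -rcosetM.
  case: repr_rcosetP => p1 Pp1; case: repr_rcosetP => p2 Pp2.
  by rewrite (eMP p1) ?groupM // (eMP p2) // eM.
exists (s + b *+ #|H : P|)%R; apply/forall_inP => x Hx; apply/eqP.
have -> : c x = (e x + (b - b ^@ x))%R by rewrite subrK.
rewrite mulrnDl actAr actZr opprD [RHS]addrACA.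
congr +%R; last by rewrite mulrnBl.
by rewrite {1}(sJ x Hx) addrAC subrr add0r.
Qed.

(** By [cocycle_transfer] the order [d] of the class of [c] divides an index
    prime to [p], for every prime [p]; so [d] is 1. *)
Lemma cocycle_local_global (gT : finGroupType) (A : {group gT})
    (abA : abelian A) (H : {group gT}) (c : gT -> fmod_of abA) :
    H \subset 'N(A) -> cocycle_on H c ->
    (forall p, prime p ->
       exists (P : {group gT}) b, p.-Sylow(H) P /\ bounded_by P c b) ->
  exists b, bounded_by H c b.
Proof.
move=> nAH cM locc.
pose good k := [exists b, bounded_by H (fun x => c x *+ k)%R b].
have syl p : prime p -> exists2 k, good k & ~~ (p %| k).
  move=> p_pr; have [P [b [sylP cP]]] := locc p p_pr.
  have [sPH _ p'i] := and3P sylP.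
  exists #|H : P|; last by rewrite -p'natE.
  by apply/existsP; apply: cocycle_transfer cP.
(* Any one prime provides a positive good [k]. *)
have ex_good : exists k, (0 < k) && good k.
  have [k gk k2] := syl 2 isT; exists k; rewrite gk andbT lt0n.
  by apply: contraNneq k2 => ->.
case: (ex_minnP ex_good) => d /andP[d_gt0 gd] min_d.
have dvd_d k : good k -> d %| k.
  move=> gk; have : good (k %% d).
    have [/existsP[a /forall_inP ca] /existsP[b /forall_inP cb]] := (gk, gd).
    apply/existsP; exists (a - b *+ (k %/ d))%R.
    apply/forall_inP => x Hx; apply/eqP.
    have ck : (c x *+ k = c x *+ d *+ (k %/ d) + c x *+ (k %% d))%R.
      by rewrite -mulrnA -mulrnDr mulnC -divn_eq.
    move: ck; rewrite (eqP (ca x Hx)) (eqP (cb x Hx)) => ck.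
    rewrite actAr actNr actZr opprD addrACA -opprD -mulNrn -mulrnDl ck.
    by rewrite addrAC subrr add0r.
  move=> gr; rewrite /dvdn; apply: contraTT (ltn_pmod k d_gt0) => r_n0.
  by rewrite -leqNgt min_d // lt0n r_n0.
have d1 : d = 1%N.
  apply/eqP; apply: contraT => d_n1.
  have p_pr : prime (pdiv d) by rewrite pdiv_prime // ltn_neqAle eq_sym d_n1.
  have [k /dvd_d dk /negP[]] := syl _ p_pr.
  exact: dvdn_trans (pdiv_dvd d) dk.
by move: gd; rewrite d1 => /existsP[b cb]; exists b.
Qed.

Theorem theorem1 (gT : finGroupType) (G N H H' : {group gT})
    (nNG : N <| G) (abN : abelian N)
    (sHG : H \subset G) (sH'G : H' \subset G)
    (ssH : supersoluble H) (ssH' : supersoluble H')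
    (cH : H \in [complements to N in G])
    (cH' : H' \in [complements to N in G])
    (locconj : forall p : nat, prime p ->
       exists (P : {group gT}) (g : gT),
         [/\ p.-Sylow(H) P, g \in G & P :^ g \subset H']) :
  exists2 g : gT, g \in G & H' :=: H :^ g.
Proof.
have nNGs := subsetP (normal_norm nNG).
have sHGs := subsetP sHG.
have [[tiH eqH] [tiH' eqH']] := (complP cH, complP cH').
have nNH : H \subset 'N(N) := subset_trans sHG (normal_norm nNG).
pose f := remgr N H'.
have fM : {in G &, {morph f : x y / x * y}} := remgrM cH' nNG.
have fH x : x \in G -> f x \in H' by move=> Gx; rewrite mem_remgr ?eqH'.
have fid x : x \in H' -> f x = x by apply: remgr_id.
have fN n x : n \in N -> x \in G -> f (n * x) = f x.
  move=> Nn Gx; rewrite fM ?(subsetP (normal_sub nNG) n) //.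
  by rewrite [f n]remgr1 ?mul1g.
have cN x : x \in G -> x^-1 * f x \in N.
  move=> Gx; rewrite -mem_lcoset -norm_rlcoset ?nNGs //.
  by rewrite rcoset_sym mem_rcoset mem_divgr ?eqH'.
pose c x := fmod abN (x^-1 * f x).
have cM : cocycle_on H c.
  move=> x y /sHGs Gx /sHGs Gy; rewrite /c -fmodJ ?nNGs // -fmodM ?cN //.
    by congr fmod; rewrite fM // conjgE invMg !mulgA !mulgK.
  by rewrite memJ_norm ?cN ?nNGs.
have fmod_commg n x : n \in N -> x \in G ->
    fmod abN [~ x, n] = (fmod abN n - fmod abN n ^@ x)%R.
  move=> Nn Gx; rewrite commgEr fmodM //; last first.
    by rewrite memJ_norm ?groupV ?nNGs.
  by rewrite fmodJ ?nNGs // fmodV actNr addrC.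
have [p p_pr|b /forall_inP cb] := cocycle_local_global nNH cM.
  have [P [g [sylP Gg sPgH']]] := locconj p p_pr.
  have : g \in H * N by rewrite (normC nNH) eqH.
  case/mulsgP => h n Hh Nn def_g; rewrite {}def_g conjsgM in sPgH'.
  exists (P :^ h)%G, (fmod abN n); split; first by rewrite pHallJ.
  apply/forall_inP => x Px.
  have Hx : x \in H.
    by move: x Px; apply/subsetP; rewrite conj_subG ?(pHall_sub sylP).
  have Gx := sHGs x Hx; rewrite -fmod_commg //.
  (* As [x ^ n] lies in [H'] and in [N :* x], it is [f x]. *)
  have xnH' : x ^ n \in H' by rewrite (subsetP sPgH') // memJ_conjg.
  have def_xn : x ^ n = (n^-1 * n ^ x^-1) * x.
    by rewrite !conjgE invgK !mulgA mulgKV.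
  have Nxn : n^-1 * n ^ x^-1 \in N by rewrite groupM ?memJ_norm ?groupV ?nNGs.
  by rewrite /c commgEl -(fid _ xnH') def_xn fN.
pose n := val b; have Nn : n \in N := fmodP b.
exists n; first exact: (subsetP (normal_sub nNG)).
have sHnH' : H :^ n \subset H'.
  apply/subsetP => _ /imsetP[x Hx ->]; have Gx := sHGs x Hx.
  suffices -> : x ^ n = f x by apply: fH.
  apply: (mulgI x^-1); rewrite -commgEl.
  have NR : [~ x, n] \in N by rewrite commgEr groupM ?memJ_norm ?groupV ?nNGs.
  apply: (injmP (injm_fmod abN)) => //=; first exact: cN.
  by rewrite fmod_commg // fmvalK -(eqP (cb x Hx)).
apply/esym/eqP; rewrite eqEcard sHnH' cardJg.
(* Both complements have order [#|G : N|]. *)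
rewrite -(leq_pmul2l (cardG_gt0 N)).
by rewrite -(TI_cardMg tiH) -(TI_cardMg tiH') eqH eqH' leqnn.
Qed.
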